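(* Let \[ C^{\geq}(x;p,1;v)=\sum_{n\ge1}x^n\sum_{w}p^{\mathrm{sper}(w)}v^{w_n}, \] where the inner sum is over all Catalan words $w=w_1\cdots w_n$ of length $n$ avoiding the pattern $(\geq,\geq)$. Then \[ C^{\geq}(x;p,1;v)=\frac{1+(1-2v)p^2x-2vp^3x^2-\sqrt{1-2p^2x+(p^4-4p^3)x^2}}{2\left((1-v)-p^2v(1-v)x+p^3v^2x^2\right)}. \]
   Context: A Catalan word of length $n\ge 0$ is a sequence $w=w_1\cdots w_n$ of non-negative integers with $w_1=0$ and $0\le w_i\le w_{i-1}+1$ for $i=2,\dots,n$. It avoids the pattern $(\geq,\geq)$ if there is no index $i$ with $w_i\ge w_{i+1}\ge w_{i+2}$. To $w$ is associated the polyomino $P(w)$ with $n$ bottom-aligned columns, the $i$-th column consisting of $w_i+1$ unit cells. $\mathrm{sper}(w)$ is half the perimeter of $P(w)$, the perimeter being the number of cell edges of $P(w)$ not shared with another cell of $P(w)$. *)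

(* Defs.v *)
(* [boolp] is used only for function extensionality and to make power series a
   choiceType. *)
From HB Require Import structures.
From mathcomp Require Import all_boot all_order all_algebra.
From mathcomp Require Import boolp.
Set Implicit Arguments.
Unset Strict Implicit.
Unset Printing Implicit Defensive.
Import GRing.Theory.
Local Open Scope ring_scope.

(* Course-of-values recursion: [cov F n] is the sequence of the first [n]
   values of the f such that f n = F [:: f 0; ...; f (n - 1)]. *)
Section CourseOfValues.
Variables (T : Type) (F : seq T -> T).

Fixpoint cov (n : nat) : seq T :=
  if n is m.+1 then rcons (cov m) (F (cov m)) else [::].

Lemma covE n : cov n = mkseq (fun i => F (cov i)) n.
Proof. by elim: n => [|n IHn] //=; rewrite mkseqS -IHn. Qed.

Lemma size_cov n : size (cov n) = n.
Proof. by rewrite covE size_mkseq. Qed.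

Lemma nth_cov x0 n i : (i < n)%N -> nth x0 (cov n) i = F (cov i).
Proof. by move=> lt_in; rewrite covE nth_mkseq. Qed.

End CourseOfValues.

(* A formal power series is its coefficient function.  The alias keeps the
   Cauchy product apart from MathComp's pointwise product of functions. *)
Definition fps (R : Type) : Type := nat -> R.

HB.instance Definition _ (R : Type) := gen_eqMixin (fps R).
HB.instance Definition _ (R : Type) := gen_choiceMixin (fps R).

Section FpsRing.
Variable R : comNzRingType.
Implicit Types a b c : fps R.

Lemma fpsP a b : (forall n, a n = b n) -> a = b.
Proof. exact: funext. Qed.

Definition fpsC (k : R) : fps R := fun n => if n == 0%N then k else 0.
Definition fpsX : fps R := fun n => (n == 1%N)%:R.

Definition fps_opp a : fps R := fun n => - a n.
Definition fps_add a b : fps R := fun n => a n + b n.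
Definition fps_mul a b : fps R := fun n => \sum_(i < n.+1) a i * b (n - i)%N.

Fact fps_addA : associative fps_add.
Proof. by move=> a b c; apply: fpsP => n; rewrite /fps_add addrA. Qed.

Fact fps_addC : commutative fps_add.
Proof. by move=> a b; apply: fpsP => n; rewrite /fps_add addrC. Qed.

Fact fps_add0 : left_id (fpsC 0) fps_add.
Proof.
by move=> a; apply: fpsP => n; rewrite /fps_add /fpsC if_same add0r.
Qed.

Fact fps_addN : left_inverse (fpsC 0) fps_opp fps_add.
Proof.
by move=> a; apply: fpsP => n; rewrite /fps_add /fps_opp /fpsC if_same addNr.
Qed.

HB.instance Definition _ :=
  GRing.isZmodule.Build (fps R) fps_addA fps_addC fps_add0 fps_addN.

Lemma fps_mulEpoly a b n m : (n < m)%N ->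
  fps_mul a b n = ((\poly_(i < m) a i) * (\poly_(i < m) b i))`_n.
Proof.
move=> lt_nm; rewrite coefM; apply: eq_bigr => i _; rewrite !coef_poly.
by rewrite (leq_ltn_trans _ lt_nm) ?leq_ord // (leq_ltn_trans _ lt_nm) ?leq_subr.
Qed.

Fact fps_mulA : associative fps_mul.
Proof.
move=> a b c; apply: fpsP => n.
pose P (d : fps R) := \poly_(i < n.+1) d i.
have PE d e i : (i < n.+1)%N -> fps_mul d e i = (P d * P e)`_i.
  exact: fps_mulEpoly.
transitivity (P a * (P b * P c))`_n.
  rewrite coefM; apply: eq_bigr => i _.
  by rewrite coef_poly ltn_ord PE // ltnS leq_subr.
rewrite mulrA coefM; apply: eq_bigr => i _.
by rewrite coef_poly ltnS leq_subr -PE.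
Qed.

Fact fps_mulC : commutative fps_mul.
Proof.
by move=> a b; apply: fpsP => n; rewrite !(@fps_mulEpoly _ _ n n.+1) // mulrC.
Qed.

Fact fps_mul1 : left_id (fpsC 1) fps_mul.
Proof.
move=> a; apply: fpsP => n; rewrite /fps_mul big_ord_recl /= subn0 mul1r.
by rewrite big1 ?addr0 // => i _; rewrite mul0r.
Qed.

Fact fps_mulDl : left_distributive fps_mul fps_add.
Proof.
move=> a b c; apply: fpsP => n; rewrite /fps_add /fps_mul -big_split /=.
by apply: eq_bigr => i _; rewrite mulrDl.
Qed.

Fact fps_oner_neq0 : fpsC 1 != 0.
Proof.
by apply/eqP => /(congr1 (fun a : fps R => a 0%N)) /eqP; rewrite oner_eq0.
Qed.

HB.instance Definition _ := GRing.Zmodule_isComNzRing.Build (fps R)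
  fps_mulA fps_mulC fps_mul1 fps_mulDl fps_oner_neq0.

Lemma coef_fpsM a b n : (a * b) n = \sum_(i < n.+1) a i * b (n - i)%N.
Proof. by []. Qed.

Lemma coef_fps1 n : (1 : fps R) n = (n == 0%N)%:R.
Proof. by rewrite [LHS]/(fpsC 1 n) /fpsC; case: eqP. Qed.

End FpsRing.

Section FpsUnitRing.
Variable R : comUnitRingType.
Implicit Types a b : fps R.

Definition fps_unit : pred (fps R) := fun a => a 0%N \is a GRing.unit.

(* b_0 = 1 / a_0 and b_n = - (a_n b_0 + ... + a_1 b_(n-1)) / a_0. *)
Definition fps_inv_rec a (s : seq R) : R :=
  if s is [::] then (a 0%N)^-1 else
  - (a 0%N)^-1 * \sum_(i < size s) s`_i * a (size s - i)%N.

(* As for every MathComp ring with units, the inverse of a non-unit is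
   itself. *)
Definition fps_inv a : fps R :=
  if fps_unit a then fun n => fps_inv_rec a (cov (fps_inv_rec a) n) else a.

Fact fps_mulVr : {in fps_unit, left_inverse 1 fps_inv *%R}.
Proof.
move=> a Ua; have a_unit : a 0%N \is a GRing.unit := Ua; apply: fpsP => n.
have {Ua} Ua : fps_unit a := Ua.
rewrite coef_fpsM coef_fps1 /fps_inv Ua big_ord_recr /= subnn.
case: n => [|n]; first by rewrite big_ord0 add0r mulVr.
pose b i := fps_inv_rec a (cov (fps_inv_rec a) i).
have -> : fps_inv_rec a (rcons (cov (fps_inv_rec a) n)
    (fps_inv_rec a (cov (fps_inv_rec a) n))) =
    - (a 0%N)^-1 * \sum_(i < n.+1) b i * a (n.+1 - i)%N.
  rewrite -[rcons _ _]/(cov (fps_inv_rec a) n.+1) {1}/fps_inv_rec size_cov.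
  have := size_cov (fps_inv_rec a) n.+1; case Es: (cov _ _) => [//|y s] _.
  rewrite -Es; congr (_ * _); apply: eq_bigr => i _.
  by rewrite nth_cov.
by rewrite mulrAC mulNr mulVr // mulN1r subrr.
Qed.

Fact fps_unitPl a b : b * a = 1 -> fps_unit a.
Proof.
move=> /(congr1 (fun c : fps R => c 0%N)).
rewrite coef_fpsM coef_fps1 big_ord1 /= => ba1.
by rewrite /fps_unit; apply/unitrPr; exists (b 0%N); rewrite mulrC.
Qed.

Fact fps_inv_out : {in [predC fps_unit], fps_inv =1 id}.
Proof. by move=> a /negbTE Ua; rewrite /fps_inv [fps_unit a]Ua. Qed.

HB.instance Definition _ := GRing.ComNzRing_hasMulInverse.Build (fps R)
  fps_mulVr fps_unitPl fps_inv_out.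

Lemma fps_unitE a : (a \is a GRing.unit) = (a 0%N \is a GRing.unit).
Proof. by []. Qed.

(* The square root with constant coefficient 1 of a series with constant
   coefficient 1: see [fps_sqrtK] and [fps_sqrt_uniq]. *)
Definition fps_sqrt_rec a (s : seq R) : R :=
  if size s is m.+1 then
    (a m.+1 - \sum_(i < m) s`_i.+1 * s`_(m - i)) / 2
  else 1.

Definition fps_sqrt a : fps R :=
  fun n => fps_sqrt_rec a (cov (fps_sqrt_rec a) n).

Lemma fps_sqrt0 a : fps_sqrt a 0%N = 1.
Proof. by []. Qed.

Lemma fps_sqrtS a n : fps_sqrt a n.+1 =
  (a n.+1 - \sum_(i < n) fps_sqrt a i.+1 * fps_sqrt a (n - i)%N) / 2.
Proof.
rewrite {1}/fps_sqrt {1}/fps_sqrt_rec size_cov; congr ((_ - _) / _).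
by apply: eq_bigr => i _; rewrite !nth_cov // ltnS ?leq_subr.
Qed.

Lemma coef_fps_sqr a n : (a ^+ 2) n.+1 =
  a 0%N * a n.+1 *+ 2 + \sum_(i < n) a i.+1 * a (n - i)%N.
Proof.
rewrite expr2 coef_fpsM big_ord_recl big_ord_recr /= subn0 subnn.
by rewrite (mulrC (a n.+1)) [X in _ + X]addrC addrA -mulr2n.
Qed.

Lemma fps_sqrtK a : (2 : R) \is a GRing.unit -> a 0%N = 1 ->
  fps_sqrt a ^+ 2 = a.
Proof.
move=> unit2 a01; apply: fpsP => -[|n].
  by rewrite expr2 coef_fpsM big_ord1 /= !fps_sqrt0 mul1r a01.
rewrite coef_fps_sqr fps_sqrt0 mul1r fps_sqrtS -mulr_natr.
by rewrite -mulrA mulVr // mulr1 subrK.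
Qed.

Lemma fps_sqrt_uniq a b : (2 : R) \is a GRing.unit ->
  b 0%N = 1 -> b ^+ 2 = a -> b = fps_sqrt a.
Proof.
move=> unit2 b01 b2a; apply: fpsP; elim/ltn_ind => -[|n] IHn.
  by rewrite b01 fps_sqrt0.
rewrite fps_sqrtS; suff -> : \sum_(i < n) fps_sqrt a i.+1 * fps_sqrt a (n - i)%N =
          \sum_(i < n) b i.+1 * b (n - i)%N.
  by rewrite -b2a coef_fps_sqr b01 mul1r -mulr_natr addrK mulrK.
by apply: eq_bigr => i _; rewrite !IHn ?ltnS ?leq_subr.
Qed.

End FpsUnitRing.

(* The positions of a word are numbered from 0. *)
Definition catalan_word (w : seq nat) : bool :=
  (head 0%N w == 0%N) && sorted (fun a b => b <= a.+1)%N w.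

Definition avoids_geq_geq (w : seq nat) : bool :=
  [forall i : 'I_(size w), (i.+2 < size w)%N ==>
     ~~ ((nth 0%N w i >= nth 0%N w i.+1)%N &&
         (nth 0%N w i.+1 >= nth 0%N w i.+2)%N)].

(* A cell is given by its lower left corner. *)
Definition cells (w : seq nat) : seq (nat * nat) :=
  [seq (i, j) | i <- iota 0 (size w), j <- iota 0 (nth 0%N w i).+1].

(* An edge is given by its left or lower endpoint, tagged with [true] if it is
   vertical and with [false] if it is horizontal. *)
Definition cell_edges (c : nat * nat) : seq (bool * (nat * nat)) :=
  let: (i, j) := c in
  [:: (true, (i, j)); (true, (i.+1, j)); (false, (i, j)); (false, (i, j.+1))].

Definition perimeter (w : seq nat) : nat :=
  let edges := flatten [seq cell_edges c | c <- cells w] in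
  size [seq e <- edges | count_mem e edges == 1%N].

(* The perimeter of P(w) is even, so that nothing is lost by the halving. *)
Definition sper (w : seq nat) : nat := (perimeter w)./2.

Lemma catalan_word_bound w : catalan_word w -> all (fun a => a < size w)%N w.
Proof.
case: w => [|a w] //= /andP[/eqP/= -> w_path] /=.
suff: forall m b, (b < m)%N -> path (fun a b => b <= a.+1)%N b w ->
    all (fun a => a < m + size w)%N w by move/(_ 1%N 0%N); apply.
elim: w {w_path} => [|c w IHw] m b //= lt_bm /andP[le_cb w_path].
have lt_cm : (c < m.+1)%N by rewrite ltnS (leq_trans le_cb).
by rewrite addnS -addSn (IHw _ c) // andbT (leq_trans lt_cm) // leq_addr.
Qed.

(* The sum over words of length n is taken over words with letters in
   {0, ..., n - 1}, which loses nothing by [catalan_word_bound]; [last 0 w] is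
   the last letter w_n of w. *)
Definition catalan_gf (R : comNzRingType) (p v : R) : fps R := fun n =>
  if n is 0 then 0 else
  \sum_(w : n.-tuple 'I_n | catalan_word (map val w) &&
                            avoids_geq_geq (map val w))
    p ^+ sper (map val w) * v ^+ last 0%N (map val w).

(* The field Q(p, v), where p and v are indeterminates. *)
Definition Qpv : fieldType := {fraction {poly {poly rat}}}.
Definition p_ : Qpv := tofrac ('X%:P : {poly {poly rat}}).
Definition v_ : Qpv := tofrac ('X : {poly {poly rat}}).

(* The quotient in the closed form is a genuine one: the constant coefficient
   2 (1 - v) of its denominator is not zero in Q(p, v). *)
Lemma denominator_unit (x := fpsX Qpv) (p := fpsC p_) (v := fpsC v_) :
  2 * ((1 - v) - p ^+ 2 * v * (1 - v) * x + p ^+ 3 * v ^+ 2 * x ^+ 2)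
    \is a GRing.unit.
Proof.
have coef0M (a b : fps Qpv) : (a * b) 0%N = a 0%N * b 0%N.
  by rewrite coef_fpsM big_ord1.
have coef0D (a b : fps Qpv) : (a + b) 0%N = a 0%N + b 0%N by [].
have coef0N (a : fps Qpv) : (- a) 0%N = - a 0%N by [].
have x0 : x 0%N = 0 by [].
rewrite fps_unitE expr2 [x ^+ 2]expr2 mulrA.
rewrite !(coef0M, coef0D, coef0N, x0) !mulr0 subr0 addr0 !coef_fps1.
rewrite unitfE mulf_neq0 //.
  rewrite -[X in X != 0]/((1 + 1 : fps Qpv) 0%N) coef0D coef_fps1.
  by rewrite -tofrac1 -tofracD tofrac_eq0 -!polyC1 -!polyCD !polyC_eq0.
rewrite -tofrac1 -tofracB tofrac_eq0 subr_eq0.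
apply/eqP => /(congr1 (fun q : {poly {poly rat}} => q`_0)).
by rewrite coef1 coefX => /eqP; rewrite oner_eq0.
Qed.

(* Main.v *)
(* Let C_k be the generating function of the words with last letter k, and A_k
   that of those among them that end with an ascent or have length 1.  Appending
   a letter adds 1 to the semiperimeter, and 1 more for an ascent, so that
     A_0 = p^2 x,  A_{k+1} = p^2 x C_k,
     C_k - A_k = (C_{k+1} - A_{k+1}) + p x A_k.
   Eliminating A gives C_{k+2} = (a + b) C_{k+1} - a b C_k, where
     a + b = 1 + p^2 x,  a b = p^2 x + p^3 x^2,  a(0) = 1,  b(0) = 0.
   As C_k has order at least k + 1 in x, only the root b contributes, and
   C_k = b^(k+1).  The sum of the C_k v^k is thus b / (1 - b v), and the closed
   form is this fraction with both terms multiplied by 2 (1 - a v). *)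
Require Import Defs.
From HB Require Import structures.
From mathcomp Require Import all_boot all_order all_algebra.
From mathcomp Require Import zify ring.
Set Implicit Arguments.
Unset Strict Implicit.
Unset Printing Implicit Defensive.
Import GRing.Theory.
Local Open Scope ring_scope.

(** * Change of the semiperimeter when a letter is appended *)

Section Perimeter.
Local Open Scope nat_scope.

Definition num_once (T : eqType) (s : seq T) : nat :=
  size [seq e <- s | count_mem e s == 1].

(** An edge met once before becomes shared and is lost, a new edge is gained, and one already
    repeated changes nothing. Both corrections appear as sums because subtraction on [nat]
    truncates. *)
Lemma num_once_rcons (T : eqType) (s : seq T) (e : T) :
  num_once (rcons s e) + (count_mem e s == 1) = num_once s + (count_mem e s == 0).
Proof.
rewrite /num_once !size_filter.
pose P x := count_mem x s == 1.
pose Q x := count_mem x (rcons s e) == 1.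
have count_Pe : count (fun x => P x && (x == e)) s = P e.
  have [Pe|/negbTE Pe] := boolP (P e).
    rewrite -[RHS](eqP Pe); apply: eq_count => x /=.
    by case: eqP => [->|]; rewrite ?andbF ?Pe.
  rewrite (@eq_count _ _ pred0) ?count_pred0 // => x /=.
  by case: eqP => [->|]; rewrite ?andbF ?Pe.
have count_Q : count Q s = count (fun x => P x && (x != e)) s.
  apply: eq_in_count => x xs; rewrite /Q /P -cats1 count_cat /= addn0.
  rewrite [e == x]eq_sym; case: (x =P e) => _ /=; last by rewrite addn0 andbT.
  by rewrite andbF addn1 eqSS -leqn0 leqNgt -has_count has_pred1 xs.
have -> : count (fun x => count_mem x (rcons s e) == 1) (rcons s e) =
    count Q s + Q e.
  by rewrite -/Q -{1}cats1 count_cat /= addn0.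
have -> : Q e = (count_mem e s == 0).
  by rewrite /Q -cats1 count_cat /= eqxx addn1 eqSS.
rewrite count_Q -/(P e) -count_Pe addnAC; congr (_ + _).
rewrite -/P -[RHS]size_filter -(count_predC (pred1 e)) !count_filter addnC.
by congr (_ + _); apply: eq_count => x /=; apply: andbC.
Qed.

Definition edges (cs : seq (nat * nat)) : seq (bool * (nat * nat)) :=
  flatten [seq cell_edges c | c <- cs].

(** Only two cells can own this edge: (i, j) as its left side and (i - 1, j) as its right side, the
    latter being absent for i = 0. *)
Lemma count_vertical_edge (cs : seq (nat * nat)) (i j : nat) :
  count_mem (true, (i, j)) (edges cs) =
  count_mem (i, j) cs + (if i is i'.+1 then count_mem (i', j) cs else 0).
Proof.
elim: cs => [|[a b] cs IHcs]; first by case: i.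
rewrite /edges /= !xpair_eqE /= -/(edges cs) IHcs; case: i {IHcs} => [|i].
  by rewrite -[a.+1 == 0]/false ?andbF !add0n !addn0.
by rewrite xpair_eqE eqSS !add0n -!addnA; congr addn; rewrite addnCA.
Qed.

Lemma count_horizontal_edge (cs : seq (nat * nat)) (i j : nat) :
  count_mem (false, (i, j)) (edges cs) =
  count_mem (i, j) cs + (if j is j'.+1 then count_mem (i, j') cs else 0).
Proof.
elim: cs => [|[a b] cs IHcs]; first by case: j.
rewrite /edges /= !xpair_eqE /= -/(edges cs) IHcs; case: j {IHcs} => [|j].
  by rewrite -[b.+1 == 0]/false ?andbF !add0n !addn0.
by rewrite xpair_eqE eqSS !add0n -!addnA; congr addn; rewrite addnCA.
Qed.

Lemma cells_rcons w b :
  cells (rcons w b) = cells w ++ [seq (size w, j) | j <- iota 0 b.+1].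
Proof.
rewrite /cells size_rcons -addn1 iotaD add0n map_cat flatten_cat /= cats0.
rewrite nth_rcons ltnn eqxx; congr (flatten _ ++ _).
by apply/eq_in_map => i; rewrite mem_iota nth_rcons => /andP[_ ->].
Qed.

Lemma count_column (n m i j : nat) :
  count_mem (i, j) [seq (n, k) | k <- iota 0 m] = (i == n) && (j < m).
Proof.
rewrite count_map; have [->|ni] := eqVneq i n.
  rewrite (@eq_count _ _ (pred1 j)) => [|k /=]; last by rewrite xpair_eqE eqxx.
  by rewrite count_uniq_mem ?iota_uniq // mem_iota.
rewrite (@eq_count _ _ pred0) ?count_pred0 // => k /=.
by rewrite xpair_eqE eq_sym (negbTE ni).
Qed.

Lemma count_cells w (i j : nat) :
  count_mem (i, j) (cells w) = (i < size w) && (j <= nth 0 w i).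
Proof.
elim/last_ind: w => [|w b IHw] //.
rewrite cells_rcons count_cat IHw size_rcons count_column nth_rcons !ltnS.
by case: ltngtP => [lt_iw|//|->]; rewrite ?addn0.
Qed.

(* The new column is built upwards, one cell at a time: each new cell adds its
   four edges, two of which become shared for every neighbour already there. *)
Lemma num_once_column a w m :
  let w' := rcons w a in
  num_once (edges (cells w' ++ [seq (size w', j) | j <- iota 0 m])) +
    2 * minn m a.+1 =
  num_once (edges (cells w')) + 2 * m + 2 * (0 < m).
Proof.
move=> w'; elim: m => [|m IHm]; first by rewrite cats0; lia.
set n := size w' in IHm *.
pose cs := cells w' ++ [seq (n, j) | j <- iota 0 m].
have -> : edges (cells w' ++ [seq (n, j) | j <- iota 0 m.+1]) =
    edges cs ++ cell_edges (n, m).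
  by rewrite -addn1 iotaD map_cat catA /edges map_cat flatten_cat.
have count_cs i j :
    count_mem (i, j) cs = ((i < n) && (j <= nth 0 w' i)) + ((i == n) && (j < m)).
  by rewrite count_cat count_cells count_column.
rewrite /= -!cat_rcons cats0.
have nS : n = (size w).+1 by rewrite /n size_rcons.
have w'a : nth 0 w' (size w) = a by rewrite nth_rcons ltnn eqxx.
set e1 := (true, (n, m)); set e2 := (true, (n.+1, m)).
set e3 := (false, (n, m)); set e4 := (false, (n, m.+1)).
(* Only the left side and the bottom of the new cell can already be present: the former if the
   previous column reaches height m, the latter if m > 0. *)
have c1 : count_mem e1 (edges cs) = (m <= a).
  rewrite count_vertical_edge {2}nS !count_cs w'a; lia.
have c2 : count_mem e2 (rcons (edges cs) e1) = 0.
  rewrite -cats1 count_cat count_vertical_edge !count_cs /= ?xpair_eqE; lia.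
have c3 : count_mem e3 (rcons (rcons (edges cs) e1) e2) = (0 < m).
  rewrite -!cats1 !count_cat count_horizontal_edge count_cs /= ?xpair_eqE.
  suff -> : (if m is k.+1 then count_mem (n, k) cs else 0) = (0 < m) by lia.
  by case Em: {1}m => [|k]; rewrite ?count_cs Em // ltnn eqxx ltnSn.
have c4 : count_mem e4 (rcons (rcons (rcons (edges cs) e1) e2) e3) = 0.
  rewrite -!cats1 !count_cat count_horizontal_edge !count_cs /= ?xpair_eqE; lia.
have := num_once_rcons (edges cs) e1.
have := num_once_rcons (rcons (edges cs) e1) e2.
have := num_once_rcons (rcons (rcons (edges cs) e1) e2) e3.
have := num_once_rcons (rcons (rcons (rcons (edges cs) e1) e2) e3) e4.
rewrite {}c1 {}c2 {}c3 {}c4.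
rewrite -/cs in IHm.
move: (num_once _) IHm (num_once _) (num_once _) (num_once _) (num_once _) => *; lia.
Qed.

Lemma sper_rcons w b : w != [::] -> b <= (last 0 w).+1 ->
  sper (rcons w b) = (sper w).+1 + (last 0 w < b).
Proof.
case/lastP: w => // w a _; rewrite last_rcons => le_ba.
have := num_once_column a w b.+1; rewrite /= -cells_rcons.
rewrite -[num_once _]/(perimeter (rcons (rcons w a) b)).
rewrite -[num_once _]/(perimeter (rcons w a)) /sper => col.
(* The increment 2 (b + 1) + 2 - 2 min (b + 1, a + 1) is 2 for b <= a and 4 for b = a + 1, the only
   possible ascent. Being even, it commutes with the halving. *)
have -> : perimeter (rcons (rcons w a) b) =
    perimeter (rcons w a) + (a < b).+1.*2 by lia.
by rewrite halfD odd_double andbF doubleK add0n; lia.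
Qed.

End Perimeter.

(** * Enumeration of the avoiding Catalan words letter by letter *)

Section Words.
Local Open Scope nat_scope.

(** Words of length at most 1 count as rising, since no letter appended to them can complete the
    pattern. *)
Definition ends_rising (w : seq nat) : bool :=
  (size w <= 1) || (nth 0 w (size w).-2 < last 0 w).

Lemma ends_rising_rcons w b : w != [::] ->
  ends_rising (rcons w b) = (last 0 w < b).
Proof.
case/lastP: w => // w a _; rewrite /ends_rising !last_rcons !size_rcons /=.
by rewrite nth_rcons size_rcons ltnSn nth_rcons ltnn eqxx.
Qed.

Lemma catalan_word_rcons w b : w != [::] ->
  catalan_word (rcons w b) = catalan_word w && (b <= (last 0 w).+1).
Proof. by case: w => // a w _; rewrite /catalan_word /= rcons_path andbA. Qed.

Lemma avoids_geq_geqP w :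
  reflect (forall i, i.+2 < size w ->
             ~~ ((nth 0 w i >= nth 0 w i.+1) && (nth 0 w i.+1 >= nth 0 w i.+2)))
    (avoids_geq_geq w).
Proof.
apply: (iffP forallP) => [avw i lt_i|avw i]; last exact/implyP/avw.
by have /implyP/(_ lt_i) := avw (Ordinal (ltnW (ltnW lt_i))).
Qed.

(** The only new triple consists of the last three letters; it is forbidden when a final weak
    descent of [w] is followed by another one. *)
Lemma avoids_geq_geq_rcons w b : w != [::] ->
  avoids_geq_geq (rcons w b) =
  avoids_geq_geq w && (ends_rising w || (last 0 w < b)).
Proof.
case/lastP: w => // w a _; rewrite last_rcons /ends_rising last_rcons.
rewrite size_rcons /=; set s := rcons w a; set n := size w.
have sn : nth 0 s n = a by rewrite nth_rcons ltnn eqxx.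
have size_s : size s = n.+1 by rewrite size_rcons.
have nth_s i : i <= n -> nth 0 (rcons s b) i = nth 0 s i.
  by move=> le_in; rewrite nth_rcons size_s ltnS le_in.
have nth_b : nth 0 (rcons s b) n.+1 = b by rewrite nth_rcons size_s ltnn eqxx.
apply/avoids_geq_geqP/andP => [av|[/avoids_geq_geqP av last_ok] i].
  split.
    apply/avoids_geq_geqP => i; rewrite size_s => lt_i.
    by have := av i; rewrite size_rcons size_s !nth_s; [apply | ..]; lia.
  case: (posnP n) => [-> //|n_gt0].
  have := av n.-1; rewrite size_rcons size_s (prednK n_gt0) nth_b !nth_s ?sn; lia.
rewrite size_rcons size_s ltnS => le_i.
have [lt_i|ge_i] := ltnP i.+2 n.+1.
  by rewrite !nth_s; [apply: av; rewrite size_s | lia..].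
have in1 : i.+1 = n by lia.
have -> : i = n.-1 by lia.
rewrite (prednK (_ : 0 < n)) ?nth_b ?nth_s ?sn; lia.
Qed.

Definition next_letters (w : seq nat) : seq nat :=
  [seq b <- iota 0 (last 0 w).+2 | ends_rising w || (last 0 w < b)].

(** The index is shifted: [words n] holds words of length n + 1, so that a last letter always
    exists. *)
Fixpoint words (n : nat) : seq (seq nat) :=
  if n is m.+1 then [seq rcons w b | w <- words m, b <- next_letters w]
  else [:: [:: 0]].

Lemma mem_words n w :
  (w \in words n) = [&& size w == n.+1, catalan_word w & avoids_geq_geq w].
Proof.
elim: n w => [|n IHn] w.
  rewrite inE; case: w => [|a [|b w]] //=; last by rewrite eqseq_cons andbF.
  have -> : avoids_geq_geq [:: a] by apply/avoids_geq_geqP.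
  by rewrite eqseq_cons /catalan_word /= !andbT.
case/lastP: w => [|w b].
  by apply/negbTE/allpairsPdep => -[w [b [_ _ /(congr1 size)]]]; rewrite size_rcons.
have [->|w0] := eqVneq w [::].
  apply/negbTE/allpairsPdep => -[w' [b' [+ _ /(congr1 size)]]].
  by rewrite IHn !size_rcons => /and3P[/eqP ->].
rewrite size_rcons eqSS catalan_word_rcons // avoids_geq_geq_rcons //.
apply/allpairsPdep/idP => [[w' [b' [w'n b'n /rcons_inj[-> ->]]]]|].
  move: w'n b'n; rewrite IHn mem_filter mem_iota add0n ltnS => /and3P[-> -> ->].
  by rewrite /= andbC.
case/and3P=> wn /andP[wc wb] /andP[wa wr]; exists w, b.
by rewrite IHn wn wc wa mem_filter wr mem_iota.
Qed.

Lemma words_uniq n : uniq (words n).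
Proof.
elim: n => //= n IHn; apply: allpairs_uniq_dep => //.
  by move=> w _; rewrite filter_uniq ?iota_uniq.
by move=> [w b] [w' b'] _ _ /= /rcons_inj[-> ->].
Qed.

Lemma words_neq0 n w : w \in words n -> w != [::].
Proof. by rewrite mem_words; case: w. Qed.

Lemma last_words n w : w \in words n -> last 0 w <= n.
Proof.
rewrite mem_words => /and3P[/eqP wn wc _]; have /allP := catalan_word_bound wc.
by case: w wn {wc} => // a w wn /(_ _ (mem_last a w)); rewrite wn ltnS.
Qed.

(** Links the recursive list to the tuples summed over in [catalan_gf]. Letters of a Catalan word
    are below its length, so turning them into ordinals loses nothing. *)
Lemma perm_words n :
  perm_eq (words n)
    [seq map val t |
       t : n.+1.-tuple 'I_n.+1 <- enum {: n.+1.-tuple 'I_n.+1} &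
       catalan_word (map val t) && avoids_geq_geq (map val t)].
Proof.
apply: uniq_perm; first exact: words_uniq.
  rewrite map_inj_uniq ?filter_uniq -?enumT ?enum_uniq //.
  by move=> t t' /(inj_map val_inj)/val_inj.
move=> w; rewrite mem_words; apply/idP/mapP => [/and3P[/eqP wn wc wa]|[t]].
  have wK : map val (map (inord : nat -> 'I_n.+1) w) = w.
    rewrite -map_comp map_id_in // => a aw /=; rewrite inordK // -wn.
    exact: (allP (catalan_word_bound wc)).
  have wn' : size (map (inord : nat -> 'I_n.+1) w) == n.+1 by rewrite size_map wn.
  by exists (Tuple wn'); rewrite ?mem_filter /= wK ?wc ?wa -?enumT ?mem_enum.
by rewrite mem_filter => /andP[/andP[tc ta] _] ->; rewrite size_map size_tuple tc ta eqxx.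
Qed.

End Words.

(** * Recurrences for the weights of words with a given last letter *)

Section GeneratingFunctions.
Variables (R : comNzRingType) (p v : R).

Lemma sum_seq_pred1 (s : seq nat) (k : nat) (Q : pred nat) (F : nat -> R) :
  uniq s ->
  \sum_(b <- s | (b == k) && Q b) F b = if (k \in s) && Q k then F k else 0.
Proof.
move=> s_uniq; case: ifP => [/andP[ks Qk]|kQ]; last first.
  rewrite big_seq_cond big1 // => b /and3P[bs /eqP bk Qb].
  by move: kQ; rewrite -bk bs Qb.
rewrite big_mkcond (bigD1_seq k) //= eqxx Qk big1 ?addr0 // => b /negbTE ->.
by [].
Qed.

(* Words of length n + 1 with last letter k, according to whether or not they
   end with an ascent (words of length 1 are put in the first class). *)
Definition weight (t : bool) (k n : nat) : R :=
  \sum_(w <- words n | (last 0%N w == k) && (ends_rising w == t)) p ^+ sper w.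

(** A word has at most one extension by the letter k; the factor [p ^+ t.+1] is p^2 for an ascent
    and p otherwise, by [sper_rcons]. *)
Lemma weightS t k n :
  weight t k n.+1 =
  \sum_(w <- words n | (k \in next_letters w) && ((last 0%N w < k)%N == t))
    p ^+ sper w * p ^+ t.+1.
Proof.
rewrite /weight /= big_mkcond big_allpairs_dep /= [RHS]big_mkcond.
rewrite big_seq [RHS]big_seq; apply: eq_bigr => w ws; have w0 := words_neq0 ws.
rewrite -big_mkcond.
under eq_bigl do rewrite last_rcons ends_rising_rcons //.
rewrite sum_seq_pred1 ?filter_uniq ?iota_uniq //.
case: ifP => // /andP[]; rewrite mem_filter mem_iota add0n ltnS => /andP[_ le_k].
by move=> /eqP <-; rewrite sper_rcons // -exprD addSnnS.
Qed.

Lemma weight_rise0 n : weight true 0 n = if n is 0 then p ^+ 2 else 0.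
Proof.
case: n => [|n]; last by rewrite weightS big1 // => w; rewrite ltn0 andbF.
by rewrite /weight /= big_mkcond big_seq1.
Qed.

Lemma weight_riseS k n : weight true k.+1 n =
  if n is n'.+1 then p ^+ 2 * (weight true k n' + weight false k n') else 0.
Proof.
case: n => [|n]; first by rewrite /weight /= big_mkcond big_seq1.
rewrite weightS /weight (bigID ends_rising) /= mulrDr !mulr_sumr.
congr (_ + _); apply: eq_big => [w|w _]; rewrite 1?mulrC //.
  by rewrite mem_filter mem_iota !eqb_id; case: ends_rising => /=; lia.
by rewrite mem_filter mem_iota eqb_id eqbF_neg; case: ends_rising => /=; lia.
Qed.

(** A weak descent to k must follow a rising word with last letter at least k. Splitting off the
    words with last letter exactly k leaves the condition for k + 1. *)
Lemma weight_fall k n : weight false k n =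
  weight false k.+1 n + (if n is n'.+1 then p * weight true k n' else 0).
Proof.
case: n => [|n].
  by rewrite /weight /= !big_cons !big_nil /ends_rising /= !andbF addr0.
have fallE j : weight false j n.+1 =
    \sum_(w <- words n | ends_rising w && (j <= last 0%N w)%N) p ^+ sper w * p.
  rewrite weightS; apply: eq_bigl => w.
  rewrite mem_filter mem_iota add0n ltnS eqbF_neg -leqNgt.
  by case: ends_rising => /=; lia.
rewrite !fallE (bigID (fun w => last 0%N w == k)) [LHS]addrC /=; congr (_ + _).
  by apply: eq_bigl => w; case: ends_rising => //=; lia.
rewrite /weight mulr_sumr; apply: eq_big => [w|w _]; last exact: mulrC.
by rewrite eqb_id; case: ends_rising => /=; lia.
Qed.

(** The bound [N] is free so that a single truncation of the sum over k serves all coefficients of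
    low order. *)
Lemma catalan_gfE n N : (n <= N)%N ->
  catalan_gf p v n.+1 =
  \sum_(k < N.+1) v ^+ k * (weight true k n + weight false k n).
Proof.
move=> le_nN.
transitivity (\sum_(w <- words n) p ^+ sper w * v ^+ last 0%N w).
  by rewrite (perm_big _ (perm_words n)) big_map big_filter big_enum_cond.
rewrite big_seq (partition_big (fun w => inord (last 0%N w) : 'I_N.+1) predT) //.
apply: eq_bigr => k _.
transitivity (v ^+ k * \sum_(w <- words n | last 0%N w == k) p ^+ sper w).
  rewrite mulr_sumr [RHS]big_seq_cond; apply: eq_big => [w|w].
    have [ws|//] := boolP (w \in words n).
    have lt_w : (last 0%N w < N.+1)%N by rewrite ltnS (leq_trans (last_words ws)).
    by rewrite -val_eqE /= inordK.
  case/andP=> ws /eqP <-; rewrite mulrC inordK //.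
  by rewrite ltnS (leq_trans (last_words ws)).
rewrite (bigID ends_rising) /weight; congr (_ * (_ + _)).
  by apply: eq_bigl => w; rewrite eqb_id.
by apply: eq_bigl => w; rewrite eqbF_neg.
Qed.

Lemma weight_eq0 t k n : (n < k)%N -> weight t k n = 0.
Proof.
move=> lt_nk; rewrite /weight big_seq_cond big1 // => w /andP[ws /andP[/eqP wk _]].
by have := last_words ws; rewrite wk leqNgt lt_nk.
Qed.

End GeneratingFunctions.

(** * Coefficients of products and sums of power series *)

Section FpsCoefficients.
Variable R : comNzRingType.
Implicit Types (a b : fps R) (c : R).

Lemma fpsCM c c' : fpsC (c * c') = fpsC c * fpsC c'.
Proof.
apply: fpsP => n; rewrite coef_fpsM big_ord_recl subn0 big1 => [|i _].
  by rewrite addr0 /fpsC; case: n => [|n] /=; rewrite ?mulr0.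
by rewrite {1}/fpsC mul0r.
Qed.

Lemma coef_fpsCM c a n : (fpsC c * a) n = c * a n.
Proof.
rewrite coef_fpsM big_ord_recl subn0 big1 ?addr0 // => i _.
by rewrite {1}/fpsC mul0r.
Qed.

Lemma coef_fpsXM a n : (fpsX R * a) n = if n is m.+1 then a m else 0.
Proof.
rewrite coef_fpsM big_ord_recl {1}/fpsX mul0r add0r.
case: n => [|n]; first by rewrite big_ord0.
rewrite big_ord_recl /fpsX mul1r big1 ?addr0 ?subSS ?subn0 // => i _.
by rewrite mul0r.
Qed.

Lemma coef_fpsD a b n : (a + b) n = a n + b n.
Proof. by []. Qed.

Lemma coef_fpsN a n : (- a) n = - a n.
Proof. by []. Qed.

Lemma coef_fps_sum m (F : 'I_m -> fps R) n : (\sum_(i < m) F i) n = \sum_(i < m) F i n.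
Proof.
elim: m F => [|m IHm] F; last by rewrite !big_ord_recl coef_fpsD IHm.
by rewrite !big_ord0 /=; case: n.
Qed.

Lemma coef_fpsM_low a b n : (forall m, (m <= n)%N -> a m = 0) -> (a * b) n = 0.
Proof.
by move=> a_low; rewrite coef_fpsM big1 // => i _; rewrite a_low ?mul0r // leq_ord.
Qed.

End FpsCoefficients.

(** * Solution of the recurrence in the last letter *)

Section LastLetter.
Variables (R : comUnitRingType) (p0 v0 : R).

Let x := fpsX R.
Let p : fps R := fpsC p0.
Let v : fps R := fpsC v0.

Definition rise_gf k : fps R :=
  fun n => if n is m.+1 then weight p0 true k m else 0.
Definition fall_gf k : fps R :=
  fun n => if n is m.+1 then weight p0 false k m else 0.
Definition last_gf k : fps R := rise_gf k + fall_gf k.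

Lemma rise_gf0 : rise_gf 0 = p ^+ 2 * x.
Proof.
apply: fpsP => n; rewrite expr2 -fpsCM coef_fpsCM /rise_gf /x /fpsX.
case: n => [|n]; first by rewrite mulr0.
by rewrite weight_rise0; case: n => [|n]; rewrite ?mulr1 ?mulr0.
Qed.

Lemma rise_gfS k : rise_gf k.+1 = p ^+ 2 * x * last_gf k.
Proof.
apply: fpsP => n; rewrite expr2 -fpsCM -mulrA coef_fpsCM coef_fpsXM /rise_gf.
case: n => [|n]; first by rewrite mulr0.
by rewrite weight_riseS /last_gf coef_fpsD; case: n => [|n]; rewrite //= addr0 mulr0.
Qed.

Lemma fall_gfE k : fall_gf k = fall_gf k.+1 + p * x * rise_gf k.
Proof.
apply: fpsP => n; rewrite coef_fpsD -mulrA coef_fpsCM coef_fpsXM /fall_gf.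
case: n => [|n]; first by rewrite mulr0 addr0.
by rewrite weight_fall; case: n => [|n] //=; rewrite mulr0.
Qed.

Lemma last_gf_low k n : (n <= k)%N -> last_gf k n = 0.
Proof.
by case: n => [|n] lt_nk; rewrite /last_gf coef_fpsD /= ?weight_eq0 // addr0.
Qed.

(* The recurrence below starts at the fictitious last letter -1. *)
Let L j := if j is k.+1 then last_gf k else 1.

Lemma L_rec j :
  L j.+2 = (1 + p ^+ 2 * x) * L j.+1 - (p ^+ 2 * x + p ^+ 3 * x ^+ 2) * L j.
Proof.
(* With [L 0 = 1], the equations for A_0 and for A_{k+1} become a single one. *)
have riseE : rise_gf j = p ^+ 2 * x * L j.
  by case: j => [|j]; rewrite ?rise_gfS // rise_gf0 mulr1.
rewrite /= [X in _ = _ * X - _]/last_gf fall_gfE {1}/last_gf rise_gfS.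
by rewrite {1}/last_gf riseE fall_gfE riseE; ring.
Qed.

(* The differences L (j + 1) - b L j form a geometric sequence of ratio a, which
   is a unit, while their orders in x tend to infinity: they all vanish. *)
Lemma last_gf_exp (a b : fps R) :
    a 0%N = 1 -> b 0%N = 0 -> a + b = 1 + p ^+ 2 * x ->
    a * b = p ^+ 2 * x + p ^+ 3 * x ^+ 2 ->
  forall k, last_gf k = b ^+ k.+1.
Proof.
move=> a0 b0 abD abM.
have a_unit : a \is a GRing.unit by rewrite fps_unitE a0 unitr1.
have LE j : L j.+1 - b * L j = a ^+ j * (L 1 - b * L 0).
  elim: j => [|j IHj]; first by rewrite mul1r.
  by rewrite exprS -mulrA -IHj L_rec -abD -abM; ring.
have L_low j n : (n < j)%N -> L j n = 0 by case: j => // j; apply: (@last_gf_low j n).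
have L1 : L 1 = b * L 0.
  apply/eqP; rewrite -subr_eq0; apply/eqP/fpsP => n.
  (* Up to the unit a^n the series is [L n.+1 - b * L n], whose order exceeds n because b has no
     constant term; hence its coefficient at n vanishes. *)
  rewrite -[L 1 - _](mulKr (unitrX n a_unit)) -LE mulrC coef_fpsM_low => [|m le_mn].
    by case: n.
  rewrite coef_fpsD coef_fpsN L_low // coef_fpsM big_ord_recl b0 mul0r !add0r.
  rewrite big1 ?oppr0 // => i _; rewrite L_low ?mulr0 // lift0; have := ltn_ord i; lia.
have {}LE j : L j.+1 = b * L j.
  by apply/eqP; rewrite -subr_eq0 LE L1 subrr mulr0.
move=> k; rewrite -[last_gf k]/(L k.+1).
by elim: k => [|k IHk]; rewrite LE ?mulr1 ?IHk // -exprS.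
Qed.

(** The sum of the C_k v^k is geometric but infinite. For the coefficient at n it is cut to [F]: the
    omitted terms and the remainder of the finite geometric sum have order above n. *)
Lemma catalan_gf_mul (b : fps R) : (forall k, last_gf k = b ^+ k.+1) ->
  catalan_gf p0 v0 * (1 - b * v) = b.
Proof.
move=> lastE; apply: fpsP => n.
pose F := \sum_(k < n.+1) v ^+ k * last_gf k.
have vX k : v ^+ k = fpsC (v0 ^+ k).
  by elim: k => // k IHk; rewrite !exprS IHk fpsCM.
have FM : F * (1 - b * v) = b - v ^+ n.+1 * last_gf n.+1.
  have -> : F = b * \sum_(k < n.+1) (b * v) ^+ k.
    rewrite mulr_sumr; apply: eq_bigr => k _.
    by rewrite lastE exprMn exprS; ring.
  rewrite -mulrA [_ * (1 - _)]mulrC -[1 - _]opprB mulNr -subrX1 lastE.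
  by rewrite exprMn [b ^+ n.+2]exprS; ring.
rewrite -[catalan_gf _ _](subrK F) mulrDl coef_fpsD coef_fpsM_low ?add0r.
  by rewrite FM coef_fpsD coef_fpsN vX coef_fpsCM last_gf_low // mulr0 subr0.
case=> [|m] le_mn; rewrite coef_fpsD coef_fpsN /F coef_fps_sum.
  by rewrite big1 ?subr0 // => k _; rewrite vX coef_fpsCM last_gf_low // mulr0.
rewrite (@catalan_gfE _ _ _ m n) ?(ltnW le_mn) //.
apply/eqP; rewrite subr_eq0; apply/eqP/eq_bigr => k _.
by rewrite vX coef_fpsCM.
Qed.

End LastLetter.

(** * The closed form over Q(p, v) *)

Lemma fps2_unit (R : comUnitRingType) :
  (2 : R) \is a GRing.unit -> (2 : fps R) \is a GRing.unit.
Proof. by rewrite fps_unitE [X in _ -> X \is a _](coef_fpsD 1 1) !coef_fps1. Qed.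

Lemma Qpv2_unit : (2 : Qpv) \is a GRing.unit.
Proof.
by rewrite unitfE -[2]/(1 + 1) -tofrac1 -tofracD tofrac_eq0 -!polyC1 -!polyCD !polyC_eq0.
Qed.

Theorem theorem3p2 :
  let x : fps Qpv := fpsX Qpv in
  let p : fps Qpv := fpsC p_ in
  let v : fps Qpv := fpsC v_ in
  catalan_gf p_ v_ =
    (1 + (1 - 2 * v) * p ^+ 2 * x - 2 * v * p ^+ 3 * x ^+ 2
       - fps_sqrt (1 - 2 * p ^+ 2 * x + (p ^+ 4 - 4 * p ^+ 3) * x ^+ 2))
    / (2 * ((1 - v) - p ^+ 2 * v * (1 - v) * x + p ^+ 3 * v ^+ 2 * x ^+ 2)).
Proof.
move=> x p v; set D := 1 - 2 * p ^+ 2 * x + _; set S := fps_sqrt D.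
have unit2 := fps2_unit Qpv2_unit.
have coefXM (f : fps Qpv) : (f * x) 0%N = 0 by rewrite mulrC coef_fpsXM.
have D0 : D 0%N = 1.
  rewrite /D expr2 [_ * (x * x)]mulrA 2!coef_fpsD coef_fpsN !coefXM.
  by rewrite coef_fps1 subr0 addr0.
have S2 : S ^+ 2 = D by apply: fps_sqrtK; first exact: Qpv2_unit.
(* These are the roots of t^2 - (1 + p^2 x) t + p^2 x + p^3 x^2, of discriminant [D]. As [S] has
   constant coefficient 1, the minus sign selects the root vanishing at x = 0. *)
pose b := (1 + p ^+ 2 * x - S) / 2; pose a := 1 + p ^+ 2 * x - b.
have b2 : 2 * b = 1 + p ^+ 2 * x - S by rewrite mulrC divrK.
have b0 : b 0%N = 0.
  have := congr1 (fun f : fps Qpv => f 0%N) b2.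
  rewrite mulr_natl mulr2n !coef_fpsD coef_fpsN coefXM coef_fps1 addr0 subrr.
  by rewrite -mulr2n -mulr_natl => /(canRL (mulKr Qpv2_unit)); rewrite mulr0.
have a0 : a 0%N = 1.
  by rewrite /a !coef_fpsD coef_fpsN b0 coefXM coef_fps1 addr0 subr0.
have abM : a * b = p ^+ 2 * x + p ^+ 3 * x ^+ 2.
  (* Multiplying by 4 clears the halves and turns the product into the difference of squares (1 +
     p^2 x)^2 - S^2. *)
  apply: (mulrI unit2); apply: (mulrI unit2).
  have -> : 2 * (2 * (a * b)) = (2 * (1 + p ^+ 2 * x) - 2 * b) * (2 * b).
    by rewrite /a; ring.
  have SE : S = 1 + p ^+ 2 * x - 2 * b by rewrite b2; ring.
  rewrite b2; have -> : (2 * (1 + p ^+ 2 * x) - (1 + p ^+ 2 * x - S)) *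
      (1 + p ^+ 2 * x - S) = (1 + p ^+ 2 * x) ^+ 2 - S ^+ 2 by ring.
  by rewrite S2 /D; ring.
have abD : a + b = 1 + p ^+ 2 * x by rewrite subrK.
have CE := catalan_gf_mul v_ (last_gf_exp a0 b0 abD abM).
apply: (canRL (mulrK denominator_unit)); rewrite -/x -/p -/v in CE *.
(* The denominator is symmetric in a and b, so it splits over the roots, and [CE] absorbs the factor
   1 - b v. *)
have -> : 2 * (1 - v - p ^+ 2 * v * (1 - v) * x + p ^+ 3 * v ^+ 2 * x ^+ 2) =
    (1 - b * v) * (2 * (1 - a * v)).
  transitivity (2 * (1 - (a + b) * v + a * b * v ^+ 2)); last by ring.
  by rewrite abD abM; ring.
rewrite [LHS]mulrA CE.
transitivity (2 * b - 2 * v * (a * b)); first by ring.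
by rewrite b2 abM; ring.
Qed.
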